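(* Let $r$ and $s$ be positive integers with $s\leq r$, and let $n\geq 1$. For every coloring of the edges of the complete graph $K_n$ with $r$ colors such that no triangle has its three edges colored with three distinct colors, there is a set $S$ of at most $s$ colors such that the graph $G_S$ on the vertex set of $K_n$, consisting of exactly the edges whose color lies in $S$, has chromatic number at least $n^{s/r}$.
   Context: A triangle whose three edges have three distinct colors is called a rainbow triangle; an $r$-coloring of the edges of a complete graph with no rainbow triangle is called a Gallai-$r$-coloring. *)

(* Defs.v *)
From mathcomp Require Import all_boot all_order all_algebra.
From mathcomp Require Import all_classical all_reals all_analysis.

Set Implicit Arguments.
Unset Strict Implicit.
Unset Printing Implicit Defensive.

Record sgraph (T : finType) := SGraph {
  adj : rel T;
  adj_sym : symmetric adj;
  adj_irrefl : irreflexive adj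
}.

Definition proper_coloring (T : finType) (G : sgraph T) (k : nat)
    (f : {ffun T -> 'I_k}) : bool :=
  [forall x, forall y, adj G x y ==> (f x != f y)].

Definition colorable (T : finType) (G : sgraph T) (k : nat) : bool :=
  [exists f : {ffun T -> 'I_k}, proper_coloring G f].

Lemma colorable_ex (T : finType) (G : sgraph T) : exists k, colorable G k.
Proof.
exists #|T|; apply/existsP; exists [ffun x => enum_rank x].
apply/forallP => x; apply/forallP => y; apply/implyP => xy; rewrite !ffunE.
by apply/eqP => /enum_rank_inj exy; rewrite exy adj_irrefl in xy.
Qed.

Definition chromatic_number (T : finType) (G : sgraph T) : nat :=
  ex_minn (colorable_ex G).

(* An edge of the complete graph on T is a two-element set [set x; y]; the
   values of an edge coloring on other sets are never used. *)
Definition edge_coloring (T : finType) (r : nat) := {set T} -> 'I_r.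

Definition rainbow_triangle (T : finType) (r : nat) (c : edge_coloring T r)
    (x y z : T) : Prop :=
  [/\ x != y, y != z & x != z] /\
  [/\ c [set x; y] != c [set y; z], c [set y; z] != c [set x; z]
    & c [set x; y] != c [set x; z]].

Definition gallai_coloring (T : finType) (r : nat) (c : edge_coloring T r) :
    Prop :=
  forall x y z : T, ~ rainbow_triangle c x y z.

Definition color_adj (T : finType) (r : nat) (c : edge_coloring T r)
    (S : {set 'I_r}) : rel T :=
  fun x y => (x != y) && (c [set x; y] \in S).

Lemma color_adj_sym (T : finType) (r : nat) (c : edge_coloring T r)
    (S : {set 'I_r}) : symmetric (color_adj c S).
Proof. by move=> x y; rewrite /color_adj eq_sym finset.setUC. Qed.

Lemma color_adj_irrefl (T : finType) (r : nat) (c : edge_coloring T r)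
    (S : {set 'I_r}) : irreflexive (color_adj c S).
Proof. by move=> x; rewrite /color_adj eqxx. Qed.

Definition color_graph (T : finType) (r : nat) (c : edge_coloring T r)
    (S : {set 'I_r}) : sgraph T :=
  SGraph (color_adj_sym c S) (color_adj_irrefl c S).

(* Main.v *)
Require Import Defs.
From mathcomp Require Import all_boot all_order all_algebra.
From mathcomp Require Import perm.
From mathcomp Require Import all_classical all_reals all_analysis.
Import Order.TTheory GRing.Theory Num.Theory.

(** Fix a proper coloring [f S] of [color_graph c S] for every [S] and let
    [a_S(X)] be the number of colors which [f S] uses on [X].  The product of
    the [a_S(X)] over all [s]-sets [S] is at least [|X| ^ K], where [K] is the
    number of [s]-sets through a given color; since [K / 'C(r, s) = s / r],
    some [S] satisfies the claim.

    The product inequality is by induction on [X].  By Gallai's theorem, [X]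
    splits into parts [X_i], each pair of parts being joined in a single color,
    with only two colors [a], [b] between parts.  If [S] contains both colors,
    then the [f S]-images of the parts are disjoint, so
    [a_S(X) >= \sum_i a_S(X_i)].  If [S] contains [a] but not [b] and [S'] is
    obtained from [S] by swapping [a] and [b], then the products of the
    [f S]-image and the [f S']-image of the parts are disjoint, so
    [a_S(X) a_S'(X) >= \sum_i a_S(X_i) a_S'(X_i)].  There are exactly [K] such
    sums, one for each [s]-set through [a], and Hoelder's inequality combines
    them with the induction hypothesis for the parts. *)

Set Implicit Arguments.
Unset Strict Implicit.
Unset Printing Implicit Defensive.
Local Open Scope ring_scope.

(** * Components of a color class inside a vertex set *)

(** Membership in [X] is built into the relation, so that [connect (link c X i)] gives the
    components of color [i] inside [X] while the vertex type stays [T]. *)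
Definition link (T : finType) (r : nat) (c : edge_coloring T r) (X : {set T})
    (i : 'I_r) : rel T :=
  fun x y => [&& x \in X, y \in X, x != y & c [set x; y] == i].

Definition used (T : finType) (r : nat) (c : edge_coloring T r) (X : {set T})
    (i : 'I_r) : bool :=
  [exists x, exists y, link c X i x y].

Lemma usedP (T : finType) (r : nat) (c : edge_coloring T r) (X : {set T})
  (i : 'I_r) : reflect (exists x y, link c X i x y) (used c X i).
Proof.
apply: (iffP existsP) => [[x /existsP[y xy]]|[x [y xy]]]; first by exists x, y.
by exists x; apply/existsP; exists y.
Qed.

Lemma link_sym (T : finType) (r : nat) (c : edge_coloring T r) (X : {set T})
  (i : 'I_r) : symmetric (link c X i).
Proof.
by move=> x y; rewrite /link eq_sym finset.setUC !andbA [(x \in X) && _]andbC.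
Qed.

Lemma connect_link_sym (T : finType) (r : nat) (c : edge_coloring T r)
  (X : {set T}) (i : 'I_r) : connect_sym (link c X i).
Proof. exact/sym_connect_sym/link_sym. Qed.

Lemma gallai_eq (T : finType) (r : nat) (c : edge_coloring T r) (x y z : T) :
  gallai_coloring c -> x != y -> y != z -> x != z ->
  c [set x; y] != c [set x; z] -> c [set y; z] != c [set x; z] ->
  c [set x; y] = c [set y; z].
Proof.
move=> gc xy yz xz h1 h2; apply/eqP/negPn/negP => h3.
by apply: (gc x y z); split; split.
Qed.

Lemma disconnected_neq (T : finType) (r : nat) (c : edge_coloring T r)
  (X : {set T}) (i : 'I_r) (x z : T) :
  x \in X -> z \in X -> ~~ connect (link c X i) x z ->
  x != z /\ c [set x; z] != i.
Proof.
move=> xX zX nxz; have xz : x != z.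
  by apply: contraNneq nxz => ->; rewrite connect0.
split=> //; apply: contra nxz => /eqP cxz; apply: connect1.
by rewrite /link xX zX xz cxz eqxx.
Qed.

(** Along an edge [x u] of color [i] inside the component, neither [x z] nor [u z] has color [i], so
    these two share a color because the triangle is not rainbow. Induction on the path does the
    rest. *)
Lemma component_module (T : finType) (r : nat) (c : edge_coloring T r)
  (X : {set T}) (i : 'I_r) (x y z : T) :
  gallai_coloring c -> z \in X -> connect (link c X i) x y ->
  ~~ connect (link c X i) x z -> c [set x; z] = c [set y; z].
Proof.
move=> gc zX /connectP[p + ->]; elim: p x => //= u p IH x /andP[xu pu] nxz.
have nuz : ~~ connect (link c X i) u z.
  by apply: contra nxz => uz; apply: connect_trans (connect1 xu) uz.
rewrite -IH //; case/and4P: xu => xX uX xu /eqP cxu.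
have [xz cxz] := disconnected_neq xX zX nxz.
have [uz cuz] := disconnected_neq uX zX nuz.
rewrite (finset.setUC [set u]); apply: gallai_eq; rewrite ?cxu //.
  by rewrite eq_sym.
by rewrite finset.setUC.
Qed.

(** The witness [y'] is the vertex just before the path first reaches [v]; up to there the path
    avoids [v]. *)
Lemma connect_to_neighbour (T : finType) (r : nat) (c : edge_coloring T r)
  (X : {set T}) (l : 'I_r) (v y : T) :
  y \in X :\ v -> connect (link c X l) y v ->
  exists y', [/\ connect (link c (X :\ v) l) y y', y' \in X :\ v
                 & c [set v; y'] = l].
Proof.
move=> yY /connectP[p]; elim: p y yY => [|u p IH] y yY /=.
  by move=> _ vy; rewrite vy !inE eqxx in yY.
move=> /andP[yu pu] lv; have [uv|uv] := eqVneq u v.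
  exists y; split=> //; case/and4P: yu => _ _ _; rewrite uv finset.setUC.
  by move/eqP.
case/and4P: yu => yX uX yu cyu.
have uY : u \in X :\ v by rewrite !inE uv.
have [y' [uy' y'Y cy']] := IH u uY pu lv; exists y'; split=> //.
by apply: connect_trans uy'; apply: connect1; rewrite /link yY uY yu cyu.
Qed.

(** * Gallai's theorem *)

(** Induction on [#|X|]. If every used color connected [X], all of them would meet every vertex [v].
    Deleting [v] keeps the three colors in use, so some [l] disconnects the rest, and this leaves
    room for only one color other than [l] at [v]. *)
Lemma disconnected_color (T : finType) (r : nat) (c : edge_coloring T r)
  (X : {set T}) (i j k : 'I_r) :
  gallai_coloring c -> i != j -> j != k -> i != k ->
  used c X i -> used c X j -> used c X k ->
  exists l x y, [/\ used c X l, x \in X, y \in X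
                   & ~~ connect (link c X l) x y].
Proof.
move=> gc ij jk ik; have [m] := ubnP #|X|; elim: m X => // m IH X Xm ui uj uk.
apply: contrapT => nH.
have conn l x y : used c X l -> x \in X -> y \in X -> connect (link c X l) x y.
  by move=> ul xX yX; apply/negPn/negP => nxy; apply: nH; exists l, x, y.
have incident l v : used c X l -> v \in X -> exists y, link c X l v y.
  move=> ul vX; have [a [b /and4P[aX bX ab cab]]] := usedP _ _ _ ul.
  have [w wX wv] : exists2 w, w \in X & w != v.
    have [av|av] := eqVneq a v; last by exists a.
    by exists b; rewrite // -av eq_sym.
  have /connectP[[|u p] /=] := conn _ _ _ ul vX wX.
    by move=> _ wv'; rewrite wv' eqxx in wv.
  by case/andP=> vu _ _; exists u.
have [v [_ /and4P[vX _ _ _]]] := usedP _ _ _ ui.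
set Y := X :\ v.
have inY y : y \in X -> y != v -> y \in Y by move=> yX yv; rewrite !inE yv.
(* A color seen only at [v] would, being connected, join [v] to every other
   vertex and leave no edge at [v] for the other colors. *)
have used_below l l' : used c X l -> used c X l' -> l' != l -> used c Y l.
  move=> ul ul' ll'; have [y /and4P[_ yX vy /eqP cvy]] := incident _ _ ul' vX.
  have [z /and4P[_ zX yz /eqP cyz]] := incident _ _ ul yX.
  have zv : z != v.
    by apply: contra_neq ll' => zv; rewrite -cvy -cyz zv finset.setUC.
  apply/usedP; exists y, z; rewrite /link yz cyz eqxx !inY //.
  by rewrite eq_sym.
have [l [p [q [ul pY qY npq]]]] : exists l x y,
    [/\ used c Y l, x \in Y, y \in Y & ~~ connect (link c Y l) x y].
  apply: IH; first by move: Xm; rewrite (cardsD1 v X) vX.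
  - by apply: (used_below _ j); rewrite // eq_sym.
  - by apply: (used_below _ i).
  - by apply: (used_below _ i).
have YX y : y \in Y -> y \in X by case/setD1P.
have ulX : used c X l.
  case/usedP: ul => a [b /and4P[/YX aX /YX bX ab cab]].
  by apply/usedP; exists a, b; rewrite /link aX bX ab cab.
have to_v y : y \in Y -> exists y', [/\ connect (link c Y l) y y', y' \in Y
                 & c [set v; y'] = l].
  by move=> yY; apply: connect_to_neighbour => //; apply: conn => //; apply: YX.
have [m1 [m2 [um1 um2 m1l m2l m12]]] : exists m1 m2,
    [/\ used c X m1, used c X m2, m1 != l, m2 != l & m1 != m2].
  have [il|il] := eqVneq i l; first by exists j, k; rewrite -il !(eq_sym _ i).
  have [jl|jl] := eqVneq j l; last by exists i, j.
  by exists i, k; rewrite -jl !(eq_sym _ j) (eq_sym j) ij.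
(* [l] disconnects [Y] but not [X], so [v] has an [l]-neighbour in every
   [l]-component of [Y].  This forces all edges at [v] of color other than [l]
   to have the same color. *)
have color_across x z : x \in Y -> z \in Y -> ~~ connect (link c Y l) x z ->
    c [set v; z] = l -> c [set v; x] != l -> c [set x; z] = c [set v; x].
  move=> xY zY nxz cvz cvx; have [xz cxz] := disconnected_neq xY zY nxz.
  have /setD1P[xv _] := xY; have /setD1P[zv _] := zY.
  by apply/esym/gallai_eq; rewrite ?cvz // eq_sym.
have [x1 /and4P[_ x1X vx1 /eqP cx1]] := incident _ _ um1 vX.
have [x2 /and4P[_ x2X vx2 /eqP cx2]] := incident _ _ um2 vX.
have x1Y : x1 \in Y by rewrite inY // eq_sym.
have x2Y : x2 \in Y by rewrite inY // eq_sym.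
have symY := connect_link_sym c Y l.
suff : m1 = m2 by apply/eqP.
(* Within one [l]-component, [x1] and [x2] are compared through an [l]-neighbour [z'] of [v] in
   another component. *)
have [x12|nx12] := boolP (connect (link c Y l) x1 x2).
  have [z zY nxz] : exists2 z, z \in Y & ~~ connect (link c Y l) x1 z.
    have [x1p|nx1p] := boolP (connect (link c Y l) x1 p); last by exists p.
    by exists q => //; apply: contra npq; apply: connect_trans; rewrite symY.
  have [z' [zz' z'Y cz']] := to_v z zY.
  have nxz' : ~~ connect (link c Y l) x1 z'.
    by apply: contra nxz => /connect_trans; apply; rewrite symY.
  have nxz2 : ~~ connect (link c Y l) x2 z'.
    by apply: contra nxz'; apply: connect_trans.
  rewrite -cx1 -cx2 -(color_across x1 z') ?cx1 // -(color_across x2 z') ?cx2 //.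
  exact: component_module x12 nxz'.
(* In different components, the edges [v x1], [x1 y2], [y1 y2], [y1 x2], [v x2] all get the same
   color. *)
have [y1 [xy1 y1Y cy1]] := to_v x1 x1Y; have [y2 [xy2 y2Y cy2]] := to_v x2 x2Y.
have n1 : ~~ connect (link c Y l) x1 y2.
  by apply: contra nx12 => /connect_trans; apply; rewrite symY.
have n2 : ~~ connect (link c Y l) x2 y1.
  apply: contra nx12 => x2y1; apply: connect_trans xy1 _.
  by rewrite symY.
rewrite -cx1 -cx2 -(color_across x1 y2) ?cx1 // -(color_across x2 y1) ?cx2 //.
rewrite (component_module gc y2Y xy1 n1) (component_module gc y1Y xy2 n2).
by rewrite finset.setUC.
Qed.

Lemma connect_link_in (T : finType) (r : nat) (c : edge_coloring T r)
  (X : {set T}) (l : 'I_r) (x y : T) :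
  x \in X -> connect (link c X l) x y -> y \in X.
Proof.
move=> xX /connectP[p + ->]; elim: p x xX => //= u p IH x xX /andP[xu].
by apply: IH; case/and4P: xu.
Qed.

(* The parts are the nonempty fibres of [p] on [X]; [a = b] is allowed. *)
Definition is_gallai_partition (T : finType) (r : nat) (c : edge_coloring T r)
    (X : {set T}) (p : T -> T) (a b : 'I_r) : Prop :=
  [/\ exists x y, [/\ x \in X, y \in X & p x != p y],
      forall x y, x \in X -> y \in X -> p x != p y ->
        c [set x; y] \in [set a; b]
    & forall x x' y y', x \in X -> x' \in X -> y \in X -> y' \in X ->
      p x = p x' -> p y = p y' -> p x != p y -> c [set x; y] = c [set x'; y']].

(** With at most two colors in use, singletons serve as parts. Otherwise some used color [l]
    disconnects [X]: its components are collapsed to representatives, and a partition of the smaller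
    set of representatives is pulled back. *)
Lemma gallai_partition (T : finType) (r : nat) (c : edge_coloring T r)
  (X : {set T}) : gallai_coloring c -> (1 < #|X|)%N ->
  exists p a b, is_gallai_partition c X p a b.
Proof.
move=> gc; have [m] := ubnP #|X|; elim: m X => // m IH X Xm X1.
have [x0 [y0 [x0X y0X xy0]]] := card_gt1P X1.
have two_colors a b : (forall l, used c X l -> l \in [set a; b]) ->
    exists p a b, is_gallai_partition c X p a b.
  move=> ab; exists id, a, b; split; first by exists x0, y0.
    move=> x y xX yX xy; apply: ab; apply/usedP; exists x, y.
    by rewrite /link xX yX xy /=.
  by move=> x _ y _ _ _ _ _ <- <-.
set a := c [set x0; y0].
have ua : used c X a.
  by apply/usedP; exists x0, y0; rewrite /link x0X y0X xy0 /=.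
have [b /andP[ub ba]|nb] := pickP (fun b => used c X b && (b != a)); last first.
  apply: (two_colors a a) => l ul; rewrite !inE orbb; apply/negPn/negP => la.
  by have := nb l; rewrite ul la.
have [k /andP[uk]|nk] := pickP (fun k => used c X k && (k \notin [set a; b]));
    last first.
  apply: (two_colors a b) => l ul; apply/negPn/negP => la.
  by have := nk l; rewrite ul la.
rewrite !inE negb_or => /andP[ka kb].
have [l [x [y [ul xX yX nxy]]]] := disconnected_color gc kb ba ka uk ub ua.
set rep := fingraph.root (link c X l).
have symX := connect_link_sym c X l.
have repX u : u \in X -> rep u \in X.
  by move=> uX; apply: connect_link_in uX (connect_root _ _).
have rep_color u w : u \in X -> w \in X -> rep u != rep w ->
    c [set u; w] = c [set rep u; rep w].
  move=> uX wX uw; have nuw : ~~ connect (link c X l) u w.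
    by apply: contra uw => /(fingraph.rootP symX) ruw; apply/eqP.
  rewrite (component_module gc wX (connect_root _ u) nuw).
  rewrite !(finset.setUC [set rep u]).
  apply: (component_module gc _ (connect_root _ w)); first exact: repX.
  apply: contra nuw; rewrite symX; apply: connect_trans.
  exact: connect_root.
have [||p [a' [b' [[_ [_ [/imsetP[u uX ->] /imsetP[w wX ->] puw]]] pcol
    pmod]]]] := IH (rep @: X).
(* An edge of color [l] has both ends collapsed to one representative, so the set shrinks; it keeps
   two elements because [l] does not connect [X]. *)
- rewrite ltnS in Xm; apply: leq_trans Xm.
  rewrite ltn_neqAle leq_imset_card andbT.
  apply/imset_injP => rep_inj.
  case/usedP: ul => u [w uw]; case/and4P: (uw) => uX wX /eqP uw' _; apply: uw'.
  by apply: rep_inj => //; apply/(fingraph.rootP symX)/connect1.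
- apply/card_gt1P; exists (rep x), (rep y); rewrite !imset_f //; split=> //.
  by apply: contra nxy => /eqP ruw; apply/(fingraph.rootP symX).
exists (p \o rep), a', b'; split.
- by exists u, w.
- move=> u' w' uX' wX' /= puw'; rewrite rep_color //.
    by apply: pcol => //; apply: imset_f.
  by apply: contra_neq puw' => ->.
- move=> u1 u2 w1 w2 u1X u2X w1X w2X /= pu pw puw'.
  rewrite rep_color //; last by apply: contra_neq puw' => ->.
  rewrite (rep_color u2) //; last first.
    by move: puw'; rewrite pu pw; apply: contra_neq => ->.
  by apply: pmod => //; apply: imset_f.
Qed.

(** * Hölder's inequality and counting tools *)

(** Hölder's inequality with [#|Q|] equal exponents, raised to the power [#|Q|] to avoid roots. The
    constant [M] will hold the factors of the color sets containing neither [a] nor [b]. *)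
Lemma generalized_hoelder (R : realType) (I J : finType) (P : {set I})
  (Q : {set J}) (M : R) (n : I -> R) (x : J -> I -> R) :
  (0 < #|Q|)%N -> 0 <= M -> (forall i, 0 <= n i) ->
  (forall j i, 0 <= x j i) ->
  (forall i, i \in P -> n i ^+ #|Q| <= M * \prod_(j in Q) x j i) ->
  (\sum_(i in P) n i) ^+ #|Q| <= M * \prod_(j in Q) \sum_(i in P) x j i.
Proof.
move=> Q0 M0 n0 x0 nx; set tot := fun j => \sum_(i in P) x j i.
have tot0 j : 0 <= tot j by apply: sumr_ge0.
have prod0 : 0 <= M * \prod_(j in Q) tot j.
  by rewrite mulr_ge0 // prodr_ge0.
(* A vanishing total forces [n i = 0] for all [i] in [P]; this case goes first because the totals
   become denominators. *)
have [/existsP[j /andP[jQ /eqP totj]]|] := boolP [exists j in Q, tot j == 0].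
  rewrite big1 ?expr0n ?gtn_eqF // => i iP.
  have xji : x j i = 0 by apply: (psumr_eq0P _ totj).
  have := nx i iP; rewrite (bigD1 j) //= xji mul0r mulr0 => ni0.
  have : n i ^+ #|Q| == 0 by rewrite eq_le ni0 exprn_ge0.
  by rewrite expf_eq0 => /andP[_ /eqP].
rewrite negb_exists => /forallP totN0.
(* Normalising by [tot] and [L], the claim reduces to AM-GM for each [i]. *)
set L := (M * \prod_(j in Q) tot j) `^ (#|Q|%:R)^-1.
have K0 : (#|Q|%:R : R) != 0 by rewrite pnatr_eq0 -lt0n.
have LK : L ^+ #|Q| = M * \prod_(j in Q) tot j.
  by rewrite -powR_mulrn ?powR_ge0 // -powRrM mulVf // powRr1.
have totQ j : j \in Q -> tot j != 0 by have := totN0 j; case: (j \in Q).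
rewrite -LK.
have ni i : i \in P -> n i <= L * ((\sum_(j in Q) x j i / tot j) / #|Q|%:R).
  move=> iP; have avg0 : 0 <= (\sum_(j in Q) x j i / tot j) / #|Q|%:R.
    by rewrite divr_ge0 // sumr_ge0 // => j _; rewrite divr_ge0.
  rewrite -(ler_pXn2r Q0) ?nnegrE ?(mulr_ge0 (powR_ge0 _ _)) //.
  apply: le_trans (nx i iP) _; rewrite exprMn LK.
  have -> : \prod_(j in Q) x j i =
      \prod_(j in Q) tot j * \prod_(j in Q) (x j i / tot j).
    by rewrite -big_split; apply: eq_bigr => j jQ /=; rewrite mulrC divfK ?totQ.
  rewrite mulrA ler_wpM2l //.
  by apply: (leif_AGM _).1 => j _; rewrite divr_ge0.
rewrite ler_pXn2r ?nnegrE ?sumr_ge0 ?powR_ge0 //.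
apply: (@le_trans _ _
  (\sum_(i in P) L * ((\sum_(j in Q) x j i / tot j) / #|Q|%:R))).
  exact: ler_sum.
(* For each [j] in [Q] the ratios [x j i / tot j] sum to [1] over [P], hence so do their averages
   over [Q]. *)
rewrite -mulr_sumr -mulr_suml exchange_big /=.
under eq_bigr => j jQ do rewrite -mulr_suml divff ?totQ //.
by rewrite sumr_const divff // mulr1.
Qed.

Lemma sum_card_disjoint (I T : finType) (P : {set I}) (F : I -> {set T})
  (B : {set T}) :
  (forall i, i \in P -> F i \subset B) ->
  (forall i j, i \in P -> j \in P -> i != j -> [disjoint F i & F j]) ->
  (\sum_(i in P) #|F i| <= #|B|)%N.
Proof.
move=> FB disjF.
have -> : (\sum_(i in P) #|F i| = \sum_(i in P) \sum_(x in B | x \in F i) 1)%N.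
  apply: eq_bigr => i iP; rewrite -sum1_card; apply: eq_bigl => x.
  case: (boolP (x \in F i)) => [/(fintype.subsetP (FB i iP)) -> //|].
  by rewrite andbF.
rewrite (exchange_big_dep (mem B)) /=; last by move=> i x _ /andP[].
rewrite -[leqRHS]sum1_card; apply: leq_sum => x xB.
rewrite sum1dep_card; apply/card_le1_eqP => i j.
rewrite !inE => /andP[iP /andP[_ xi]] /andP[jP /andP[_ xj]].
apply/eqP/negPn/negP => ij.
by have /pred0P/(_ x) := disjF j i jP iP ij; rewrite /= xi xj.
Qed.

(** The transposition [tperm a b] matches the sets containing [a] but not [b] with those containing
    [b] but not [a]. For [a = b] the conditional factor is always [1]. *)
Lemma prod_swap (r s : nat) (a b : 'I_r) (F : {set 'I_r} -> nat) :
  (\prod_(S : {set 'I_r} | #|S| == s) F S =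
   \prod_(S : {set 'I_r} | (#|S| == s) && (a \notin S) && (b \notin S)) F S *
   \prod_(S in [set S : {set 'I_r} | (#|S| == s) && (a \in S)])
     (F S * if b \in S then 1 else F (tperm a b @: S)))%N.
Proof.
rewrite (bigID (fun S : {set 'I_r} => a \in S)) /= mulnC.
rewrite (bigID (fun S : {set 'I_r} => b \in S)) /= mulnC mulnA mulnC.
congr muln.
rewrite big_split /=; congr muln.
  by apply: eq_bigl => S; rewrite inE.
have tinj : injective (fun S : {set 'I_r} => tperm a b @: S).
  exact/imset_inj/perm_inj.
rewrite (reindex_inj tinj) /=.
under [RHS]eq_bigr do rewrite -if_neg.
rewrite -big_mkcondr /=; apply: eq_bigl => S.
rewrite inE card_imset; last exact: perm_inj.
have ma : (a \in tperm a b @: S) = (b \in S).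
  by rewrite -{1}(tpermR a b) mem_imset //; apply: perm_inj.
have mb : (b \in tperm a b @: S) = (a \in S).
  by rewrite -{1}(tpermL a b) mem_imset //; apply: perm_inj.
by rewrite ma mb -!andbA; congr andb; rewrite andbC.
Qed.

Lemma disjoint_imset (T U : finType) (f : T -> U) (A B : {set T}) :
  (forall x y, x \in A -> y \in B -> f x != f y) ->
  [disjoint f @: A & f @: B].
Proof.
move=> fAB; apply/pred0P => z /=; apply/negP => /andP[/imsetP[x xA ->]].
by case/imsetP => y yB /eqP; apply/negP/fAB.
Qed.

Lemma disjoint_setX (T U : finType) (A A' : {set T}) (B B' : {set U}) :
  [disjoint A & A'] || [disjoint B & B'] ->
  [disjoint finset.setX A B & finset.setX A' B'].
Proof.
move=> /orP[] /pred0P AB; apply/pred0P => -[x y] /=; rewrite !inE /=.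
  by have /= := AB x; case: (x \in A); case: (x \in A'); rewrite //= andbF.
by have /= := AB y; case: (y \in B); case: (y \in B'); rewrite //= !andbF.
Qed.

(** Double counting of pairs [j \in S]; transpositions show that the count is the same for every
    color. *)
Lemma card_draws_mem (r s : nat) (i : 'I_r) :
  (r * #|[set S : {set 'I_r} | (#|S| == s) && (i \in S)]| = s * 'C(r, s))%N.
Proof.
pose K j := #|[set S : {set 'I_r} | (#|S| == s) && (j \in S)]|.
have K_const j : K j = K i.
  have tinj : injective (fun S : {set 'I_r} => tperm j i @: S).
    exact/imset_inj/perm_inj.
  rewrite /K -(card_imset _ tinj); apply: eq_card => S.
  rewrite inE; apply/imsetP/idP => [[S']|/andP[Ss iS]].
    rewrite inE => /andP[S's jS'] ->; rewrite card_imset ?S's; last first.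
      exact: perm_inj.
    by rewrite -{1}(tpermL j i) mem_imset //; apply: perm_inj.
  exists (tperm j i @: S).
    rewrite inE card_imset ?Ss; last exact: perm_inj.
    by rewrite -{1}(tpermR j i) mem_imset //; apply: perm_inj.
  rewrite -imset_comp -[LHS]imset_id; apply: eq_imset => k /=.
  by rewrite tpermK.
have -> : (r * K i = \sum_j K j)%N.
  by under eq_bigr do rewrite K_const; rewrite sum_nat_const card_ord.
under eq_bigr do rewrite /K -sum1dep_card.
rewrite (exchange_big_dep (fun S : {set 'I_r} => #|S| == s)) /=; last first.
  by move=> j S _ /andP[].
rewrite (eq_bigr (fun=> s)); last first.
  move=> S Ss; rewrite -[RHS](eqP Ss) -[RHS]sum1_card.
  by apply: eq_bigl => j; rewrite Ss.
by rewrite sum_nat_cond_const card_draws card_ord mulnC.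
Qed.

(** * The product inequality and the choice of colors *)

Lemma prod_card_image_ge (R : realType) (T : finType) (r s K : nat)
  (c : edge_coloring T r) (k : {set 'I_r} -> nat)
  (f : forall S : {set 'I_r}, T -> 'I_(k S)) (X : {set T}) :
  gallai_coloring c ->
  (forall S x y, color_adj c S x y -> f S x != f S y) ->
  (0 < K)%N ->
  (forall i : 'I_r, #|[set S : {set 'I_r} | (#|S| == s) && (i \in S)]| = K) ->
  X != finset.set0 ->
  #|X|%:R ^+ K <= (\prod_(S : {set 'I_r} | #|S| == s) #|f S @: X|)%:R :> R.
Proof.
move=> gc fP K0 cardK; have [m] := ubnP #|X|; elim: m X => // m IH X Xm X0.
have [X1|] := leqP #|X| 1.
  have -> : #|X| = 1%N by apply/eqP; rewrite eqn_leq X1 card_gt0.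
  rewrite expr1n ler1n prodn_gt0 // => S.
  by rewrite card_gt0 imset_eq0.
move=> /(gallai_partition gc)[p [a [b [[x0 [y0 [x0X y0X pxy0]]] pcol pmod]]]].
pose part i := [set x in X | p x == i].
have partX i : part i \subset X.
  by apply/fintype.subsetP => x; rewrite inE => /andP[].
pose img S i := f S @: part i.
have imgX S i : img S i \subset f S @: X by apply: imsetS.
pose sw (S : {set 'I_r}) := tperm a b @: S.
pose Q := [set S : {set 'I_r} | (#|S| == s) && (a \in S)].
pose fac (F : {set 'I_r} -> nat) S := (F S * if b \in S then 1 else F (sw S))%N.
pose M := (\prod_(S : {set 'I_r} | (#|S| == s) && (a \notin S) && (b \notin S))
   #|f S @: X|)%N.
have disj_img (S : {set 'I_r}) i j : i != j ->
    (forall x y, x \in part i -> y \in part j -> c [set x; y] \in S) ->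
    [disjoint img S i & img S j].
  move=> ij cS; apply: disjoint_imset => x y xi yj; apply: fP.
  rewrite /color_adj cS // andbT; apply: contra_neq ij => xy.
  by move: xi yj; rewrite !inE xy => /andP[_ /eqP <-] /andP[_ /eqP <-].
have part_color i j x y x' y' : i != j -> x \in part i -> y \in part j ->
    x' \in part i -> y' \in part j -> c [set x; y] = c [set x'; y'].
  rewrite !inE => ij /andP[xX /eqP xi] /andP[yX /eqP yj] /andP[x'X /eqP x'i]
    /andP[y'X /eqP y'j].
  by apply: pmod; rewrite ?xi ?yj ?x'i ?y'j.
have part_two i j x y : i != j -> x \in part i -> y \in part j ->
    c [set x; y] \in [set a; b].
  rewrite !inE => ij /andP[xX /eqP xi] /andP[yX /eqP yj].
  by have := pcol x y xX yX; rewrite xi yj !inE; apply.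
have sum_fac S : S \in Q ->
    (\sum_(i in p @: X) fac (fun S' => #|img S' i|) S
      <= fac (fun S' => #|f S' @: X|) S)%N.
  rewrite inE => /andP[_ aS]; rewrite /fac; case: ifPn => [bS|bS].
    rewrite muln1; under eq_bigr do rewrite muln1.
    apply: sum_card_disjoint => // i j _ _ ij; apply: disj_img => // x y xi yj.
    by have := part_two i j x y ij xi yj; rewrite !inE => /orP[] /eqP ->.
  rewrite -cardsX; under eq_bigr do rewrite -cardsX.
  apply: sum_card_disjoint => [i _|i j /imsetP[x xX ix] /imsetP[y yX jy] ij].
    by apply: setXS; apply: imgX.
  have xi : x \in part i by rewrite inE xX ix /=.
  have yj : y \in part j by rewrite inE yX jy /=.
  have bsw : b \in sw S.
    by rewrite -(tpermL a b) mem_imset //; apply: perm_inj.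
  (* Parts joined in color [a] are separated by the first coordinate, since [a] lies in [S]; parts
     joined in [b] by the second, since [b] lies in [sw S]. *)
  apply: disjoint_setX; have := part_two i j x y ij xi yj.
  rewrite !inE => /orP[] /eqP cxy; apply/orP; [left|right];
    apply: disj_img => // x' y' x'i y'j;
    by rewrite (part_color i j x' y' x y) // cxy.
have cardX : (#|X| = \sum_(i in p @: X) #|part i|)%N.
  rewrite -sum1_card (partition_big_imset p) /=; apply: eq_bigr => i _.
  by rewrite sum1dep_card.
rewrite (prod_swap s a b) -/M -/Q natrM natr_prod.
apply: (@le_trans _ _ (M%:R * \prod_(S in Q) \sum_(i in p @: X)
   (fac (fun S' => #|img S' i|) S)%:R)); last first.
  rewrite ler_wpM2l // ler_prod // => S SQ.
  by rewrite sumr_ge0 //= -natr_sum ler_nat sum_fac.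
(* The exponent [K] is rewritten as [#|Q|], the number of factors in Hölder's inequality. *)
rewrite cardX natr_sum -(cardK a).
apply: generalized_hoelder => //; first by rewrite cardK.
move=> i /imsetP[x xX ix]; rewrite cardK.
have xi : x \in part i by rewrite inE xX ix /=.
have part_lt : (#|part i| < #|X|)%N.
  apply: proper_card; rewrite properE partX /=; apply/fintype.subsetPn.
  have [x0i|x0i] := eqVneq (p x0) i; last by exists x0; rewrite // inE x0X.
  by exists y0; rewrite // inE y0X -x0i eq_sym.
have part0 : part i != finset.set0 by apply/set0Pn; exists x.
apply: le_trans (IH (part i) (leq_trans part_lt Xm) part0) _.
(* For sets containing neither color, the image of a part is merely bounded by the image of [X]. *)
rewrite (prod_swap s a b) -natr_prod -natrM ler_nat leq_mul2r.
apply/orP; right; apply: leq_prod => S _.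
exact/subset_leq_card/imgX.
Qed.

Lemma chromatic_colorable (T : finType) (G : sgraph T) :
  colorable G (chromatic_number G).
Proof. by rewrite /chromatic_number; case: ex_minnP. Qed.

Theorem theorem1p4 (R : realType) (r s n : nat) (r_gt0 : (0 < r)%N)
    (s_gt0 : (0 < s)%N) (le_sr : (s <= r)%N) (n_gt0 : (1 <= n)%N)
    (c : edge_coloring 'I_n r) (gallai_c : gallai_coloring c) :
  exists S : {set 'I_r}, (#|S| <= s)%N /\
    (n%:R : R) `^ (s%:R / r%:R) <= (chromatic_number (color_graph c S))%:R.
Proof.
pose k S := chromatic_number (color_graph c S).
pose f S : 'I_n -> 'I_(k S) :=
  xchoose (existsP (chromatic_colorable (color_graph c S))).
have fP S x y : color_adj c S x y -> f S x != f S y.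
  move=> xy; have /forallP/(_ x)/forallP/(_ y)/implyP :=
    xchooseP (existsP (chromatic_colorable (color_graph c S))).
  exact.
pose K := #|[set S : {set 'I_r} | (#|S| == s) && (Ordinal r_gt0 \in S)]|.
have rK : (r * K = s * 'C(r, s))%N by apply: card_draws_mem.
have K_eq i : #|[set S : {set 'I_r} | (#|S| == s) && (i \in S)]| = K.
  by apply/eqP; rewrite -(eqn_pmul2l r_gt0) rK card_draws_mem.
have K_gt0 : (0 < K)%N.
  by rewrite -(ltn_pmul2l r_gt0) muln0 rK muln_gt0 s_gt0 bin_gt0.
have T0 : [set: 'I_n]%SET != finset.set0.
  by apply/set0Pn; exists (Ordinal n_gt0); rewrite inE.
have := prod_card_image_ge R gallai_c fP K_gt0 K_eq T0.
rewrite cardsT card_ord => nK.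
apply: contrapT => nS.
have chi_lt (S : {set 'I_r}) : #|S| == s ->
    (k S)%:R < (n%:R : R) `^ (s%:R / r%:R).
  move=> /eqP Ss; rewrite ltNge; apply/negP => kS; apply: nS; exists S.
  by rewrite Ss.
(* A strict inequality between products needs at least one factor, hence an actual [s]-set [S0]. *)
have draws_gt0 : (0 < #|[set S : {set 'I_r} | #|S| == s]|)%N.
  by rewrite card_draws card_ord bin_gt0.
have [S0] := card_gt0P draws_gt0; rewrite inE => S0s.
suff : (n%:R : R) ^+ K < n%:R ^+ K by rewrite ltxx.
apply: le_lt_trans nK _; rewrite natr_prod.
apply: (@lt_le_trans _ _ (\prod_(S : {set 'I_r} | #|S| == s)
   (n%:R : R) `^ (s%:R / r%:R))).
  apply: ltr_prod; first by apply/hasP; exists S0; rewrite ?mem_index_enum.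
  move=> S Ss; rewrite ler0n /=; apply: le_lt_trans (chi_lt S Ss).
  by rewrite ler_nat (leq_trans (max_card _)) ?card_ord.
rewrite prodr_const.
have -> : #|[pred S : {set 'I_r} | #|S| == s]| = 'C(r, s).
  by rewrite -[in RHS](card_ord r) -card_draws cardsE.
rewrite -powR_mulrn ?powR_ge0 // -powRrM -powR_mulrn //.
(* By [rK], multiplying the ['C(r, s)] strict bounds gives exactly the exponent [K], which is the
   contradiction. *)
suff -> : s%:R / r%:R * 'C(r, s)%:R = K%:R :> R by [].
have r0 : (r%:R : R) != 0 by rewrite pnatr_eq0 -lt0n.
by rewrite mulrAC -natrM -rK natrM mulrAC divff // mul1r.
Qed.
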